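(* Let $T$ be a linear operator (acting on functions on $\mathbb{R}^n$) which maps every nonnegative function to a nonnegative function. Let $(p_1,q_1)$, $(p_2,q_2)$ be pairs of numbers with $q_i<0<p_i<1$ for $i=1,2$, $p_1<p_2$ and $q_1<q_2$. Suppose $T$ is of weak type $(p_1,q_1)$ and of weak type $(p_2,q_2)$ for all nonnegative functions. Let $\theta\in(0,1)$ and let $p,q$ be given by $$\frac1p=\frac{1-\theta}{p_1}+\frac{\theta}{p_2},\qquad \frac1q=\frac{1-\theta}{q_1}+\frac{\theta}{q_2}.$$ Then $T$ is of reversed strong type $(p,q)$ for all nonnegative functions; that is, there is a constant $C>0$, depending only on $p_1,p_2,q_1,q_2,\theta$ and the two weak type constants of $T$, such that $$\|Tf\|_{L^q}\ \ge\ C\,\|f\|_{L^p}\qquad\text{for all } f\in L^p(\mathbb{R}^n)\text{ with } f\ge0.$$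
   Context: Functions are measurable functions on $\mathbb{R}^n$. For real $r<1$, $r\ne0$, $f\in L^r(\mathbb{R}^n)$ means $\int_{\mathbb{R}^n}|f|^r\,dx<\infty$, and $\|f\|_{L^r}:=\big(\int_{\mathbb{R}^n}|f|^r\,dx\big)^{1/r}$; for negative exponents the conventions $0^r=+\infty$, $(+\infty)^r=0$ are used (also for the outer power $1/r$). Weak type for $q<0<p<1$: $T$ is of weak type $(p,q)$ for all nonnegative functions if there is a constant $C(p,q)>0$ (the weak type constant) such that for all nonnegative $f\in L^p(\mathbb{R}^n)$, $$\operatorname{meas}\{x:\ |Tf(x)|<\tau\}\ \le\ \Big(C(p,q)\,\frac{\|f\|_{L^p}}{\tau}\Big)^q\qquad\text{for all }\tau>0.$$ *)

(* Defs.v *)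
From HB Require Import structures.
From mathcomp Require Import all_boot all_order all_algebra.
From mathcomp Require Import all_classical all_reals all_analysis.
From mathcomp Require Import measurable_realfun.

Set Implicit Arguments.
Unset Strict Implicit.
Unset Printing Implicit Defensive.

Import Order.TTheory GRing.Theory Num.Theory.
Import numFieldNormedType.Exports.

Local Open Scope classical_set_scope.
Local Open Scope ring_scope.

(* Lebesgue measure on R^d, d = n.+1 >= 1, with the full Lebesgue              *)
(* sigma-algebra: Caratheodory's construction applied to the outer measure     *)
(*   inf { sum_k vol(B_k) | A covered by the closed boxes B_k, k : nat }.      *)
Section lebesgue_outer.
Local Open Scope ereal_scope.
Context {R : realType} {n : nat}.

Definition box (ab : 'rV[R]_n.+1 * 'rV[R]_n.+1) : set 'rV[R]_n.+1 :=
  [set x | forall i, (ab.1 ord0 i <= x ord0 i <= ab.2 ord0 i)%R].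

Definition box_vol (ab : 'rV[R]_n.+1 * 'rV[R]_n.+1) : R :=
  (\prod_i (ab.2 ord0 i - ab.1 ord0 i))%R.

Definition box_cover (A : set 'rV[R]_n.+1) :
    set (nat -> 'rV[R]_n.+1 * 'rV[R]_n.+1) :=
  [set B : nat -> 'rV[R]_n.+1 * 'rV[R]_n.+1 |
           (forall k i, ((B k).1 ord0 i <= (B k).2 ord0 i)%R) /\
           A `<=` \bigcup_k box (B k)].

Definition lebesgue_outer (A : set 'rV[R]_n.+1) : \bar R :=
  ereal_inf [set \sum_(k <oo) (box_vol (B k))%:E | B in box_cover A].

Let vol_ge0 A B k : box_cover A B -> 0 <= (box_vol (B k))%:E.
Proof.
by move=> [leB _]; rewrite lee_fin; apply: prodr_ge0 => i _; rewrite subr_ge0.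
Qed.

Let lebesgue_outer_ge0 A : 0 <= lebesgue_outer A.
Proof.
apply: le_ereal_inf_tmp => x [B AB <-{x}].
by apply: nneseries_ge0 => k _ _; exact: vol_ge0 AB.
Qed.

Let lebesgue_outer0 : lebesgue_outer set0 = 0.
Proof.
apply/eqP; rewrite eq_le lebesgue_outer_ge0 andbT.
apply: ereal_inf_lbound; exists (fun=> (0%R, 0%R)); first by split.
rewrite eseries0// => k _ _.
by rewrite /box_vol big_ord_recl/= !mxE subrr mul0r.
Qed.

Let le_lebesgue_outer : {homo lebesgue_outer : A B / A `<=` B >-> A <= B}.
Proof.
move=> A B AB; apply/ereal_inf_le_tmp => x [C [leC BC]] <-.
by exists C => //; split => //; apply: subset_trans AB BC.
Qed.

Let lebesgue_outer_sigma_subadditive : sigma_subadditive lebesgue_outer.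
Proof.
move=> A; have [[i ioo]|] := pselect (exists i, lebesgue_outer (A i) = +oo).
  rewrite (eseries_pinfty _ _ ioo) ?leey// => k _.
  by rewrite -ltNye (lt_le_trans _ (lebesgue_outer_ge0 _)).
rewrite -forallNE => Aoo.
suff add2e (e : {posnum R}) : lebesgue_outer (\bigcup_n A n) <=
    \sum_(i <oo) lebesgue_outer (A i) + e%:num%:E.
  by apply/lee_addgt0Pr => _/posnumP[].
rewrite (le_trans _ (epsilon_trick _ _ _))//.
pose P m (B : nat -> 'rV[R]_n.+1 * 'rV[R]_n.+1) := box_cover (A m) B /\
  \sum_(k <oo) (box_vol (B k))%:E <=
    lebesgue_outer (A m) + (e%:num / (2 ^ m.+1)%:R)%:E.
have [G PG] : {G : nat -> nat -> 'rV[R]_n.+1 * 'rV[R]_n.+1 &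
    forall m, P m (G m)}.
  apply: (@choice _ _ P) => m; rewrite /P /lebesgue_outer.
  set S := (X in ereal_inf X); move infS : (ereal_inf S) => iS.
  case: iS infS => [r Sr|Soo|Soo].
  - have en1 : (0 < e%:num / (2 ^ m.+1)%:R)%R by [].
    have /(lb_ereal_inf_adherent en1) : ereal_inf S \is a fin_num by rewrite Sr.
    move=> [x [B AB muBx] xS].
    by exists B; split => //; rewrite muBx -Sr; exact/ltW.
  - by have := Aoo m; rewrite /lebesgue_outer Soo.
  - by have := lebesgue_outer_ge0 (A m); rewrite /lebesgue_outer Soo.
pose v (x : nat * nat) := (box_vol (G x.1 x.2))%:E.
have v_ge0 x : 0 <= v x by exact: vol_ge0 (PG x.1).1.
apply: (@le_trans _ _ (\esum_(i in setT) v i)).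
  apply: ereal_inf_lbound => /=.
  have /card_esym/ppcard_eqP[f] := card_nat2.
  exists (uncurry G \o f).
    split => [k i|].
      case: (PG (f k).1) => -[leG _] _.
      by rewrite /= /uncurry; case: (f k) leG.
    move=> t [i _ Ait]; have [[_ /(_ _ Ait)[j _ Bt]] _] := PG i.
    by exists (f^-1%FUN (i, j)) => //=; rewrite invK ?inE.
  transitivity (\sum_(i <oo | xpredT i) v (f i)).
    by apply: eq_eseriesr => k _; rewrite /v /= /uncurry; case: (f k).
  by rewrite -(esum_pred_image v _ xpredT) ?[fun=> _]set_true// image_eq.
rewrite (_ : esum _ _ = \sum_(i <oo) \sum_(j <oo ) v (i, j)); last first.
  pose J : nat -> set (nat * nat) := fun i => [set (i, j) | j in setT].
  rewrite (_ : setT = \bigcup_k J k); last first.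
    by rewrite predeqE => -[a b]; split => // _; exists a => //; exists b.
  rewrite esum_bigcupT /=; last 2 first.
    - apply/trivIsetP => i j _ _ ij.
      rewrite predeqE => -[k m] /=; split => //= -[] [_] _ [<-{k} _].
      by move=> [m' _] [] /esym/eqP; rewrite (negbTE ij).
    - by [].
  rewrite -(image_id [set: nat]) -fun_true esum_pred_image//; last first.
    by move=> k _; exact: esum_ge0.
  apply: eq_eseriesr => /= j _.
  rewrite -(esum_pred_image v (pair j) predT)//=; last first.
    by move=> ? ? _ _; exact: (@can_inj _ _ _ snd).
  by congr esum; rewrite predeqE => -[a b]; split; move=> [i _ <-]; exists i.
apply: lee_lim.
- by apply: is_cvg_nneseries => k _ _; apply: nneseries_ge0 => m _ _.
- apply: is_cvg_nneseries => k _ _.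
  by apply: adde_ge0 => //; exact: lebesgue_outer_ge0.
- by near=> k; apply: lee_sum => i _; exact: (PG i).2.
Unshelve. all: by end_near. Qed.

HB.instance Definition _ := isOuterMeasure.Build R 'rV[R]_n.+1 lebesgue_outer
  lebesgue_outer0 lebesgue_outer_ge0 le_lebesgue_outer
  lebesgue_outer_sigma_subadditive.

End lebesgue_outer.

Definition Rn (R : realType) (n : nat) : measurableType _ :=
  caratheodory_type (@lebesgue_outer R n).

Section lebesgue.
Local Open Scope ereal_scope.
Context {R : realType} {n : nat}.

Definition leb : set (Rn R n) -> \bar R := lebesgue_outer.

Let leb0 : leb set0 = 0.
Proof. exact: outer_measure0. Qed.

Let leb_ge0 (A : set (Rn R n)) : 0 <= leb A.
Proof. exact: outer_measure_ge0. Qed.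

Let leb_semi_sigma_additive : semi_sigma_additive leb.
Proof. by move=> F mF tF mUF; exact: caratheodory_measure_sigma_additive. Qed.

HB.instance Definition _ := isMeasure.Build _ _ _ leb
  leb0 leb_ge0 leb_semi_sigma_additive.

End lebesgue.

(* x ^ r for x in [0, +oo], with 0 ^ r = +oo and (+oo) ^ r = 0 when r < 0      *)
(* (library conventions: 0^-1 = +oo and (+oo)^-1 = 0 in \bar R, but            *)
(* 0 `^ r = 0 and (+oo) `^ r = +oo also for r < 0).                            *)
Definition epow {R : realType} (x : \bar R) (r : R) : \bar R :=
  (if (r < 0)%R then (x `^ (- r))^-1 else x `^ r)%E.

Section operators.
Local Open Scope ereal_scope.
Context {R : realType} {n : nat}.
Notation X := (Rn R n).
Notation mu := (@leb R n).

Definition Lr_norm (r : R) (g : X -> \bar R) : \bar R :=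
  epow (\int[mu]_x epow `|g x| r) r^-1.

Definition memLr (r : R) (f : X -> R) : Prop :=
  measurable_fun [set: X] f /\ \int[mu]_x epow `|(f x)%:E| r < +oo.

Definition nonneg (f : X -> R) : Prop := forall x, (0 <= f x)%R.

(* A linear operator with domain [dom], whose values may be infinite (as for   *)
(* positive integral operators): T (a f + b g) exists and equals a Tf + b Tg   *)
(* as soon as Tf and Tg exist and a Tf + b Tg is defined (no +oo - oo) almost  *)
(* everywhere.  When T is finite-valued this says that [dom] is a linear       *)
(* subspace on which T is linear.                                              *)
Record linear_operator := LinearOperator {
  dom : set (X -> R) ;
  op :> (X -> R) -> (X -> \bar R) ;
  dom_measurable : forall f, dom f -> measurable_fun [set: X] f ;
  op_measurable : forall f, dom f -> measurable_fun [set: X] (op f) ;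
  op_linear : forall (a b : R) f g, dom f -> dom g ->
    {ae mu, forall x, a%:E * op f x +? b%:E * op g x} ->
    dom (fun x => a * f x + b * g x)%R /\
    {ae mu, forall x,
      op (fun y => a * f y + b * g y)%R x = a%:E * op f x + b%:E * op g x} }.

Definition preserves_nonneg (T : linear_operator) : Prop :=
  forall f, dom T f -> nonneg f -> {ae mu, forall x, 0 <= T f x}.

(* [C] is a weak type (p, q) constant of [T]. *)
Definition weak_type (T : linear_operator) (p q C : R) : Prop :=
  forall f, memLr p f -> nonneg f -> dom T f /\
    forall tau : R, (0 < tau)%R ->
      mu [set x | `|T f x| < tau%:E] <=
        epow (C%:E * Lr_norm p (EFin \o f) * (tau^-1)%:E) q.

(* [C] is a reversed strong type (p, q) constant of [T]. *)
Definition reversed_strong_type (T : linear_operator) (p q C : R) : Prop :=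
  forall f, memLr p f -> nonneg f -> dom T f /\
    C%:E * Lr_norm p (EFin \o f) <= Lr_norm q (T f).

End operators.

Arguments linear_operator : clear implicits.

(* Main.v *)
(* Truncating f to the set {1/M <= f <= M} gives g in every L^r with
   ||f||_p <= 2^(1/p) ||g||_p for M large.  Both weak type bounds apply to g,
   and since T g <= T f a.e. they bound meas {|T f| < tau}; as -q lies strictly
   between -q2 and -q1, summing over the levels tau = e^(l +- k) bounds the
   integral of |T f|^q by a multiple of (||g||_p1^(1-theta) ||g||_p2^theta)^q.
   Hoelder's inequality compares the latter with ||g||_p^q. *)
Require Import Defs.
From mathcomp Require Import all_boot all_order all_algebra.
From mathcomp Require Import all_classical all_reals all_analysis.
From mathcomp Require Import measurable_realfun ring lra.

Set Implicit Arguments.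
Unset Strict Implicit.

Import Order.TTheory GRing.Theory Num.Theory.

Local Open Scope ring_scope.

(** * Extended powers and geometric sums *)

Lemma epow_ge0 (R : realType) (x : \bar R) (r : R) :
  (0 <= x -> 0 <= epow x r)%E.
Proof. by move=> x0; rewrite /epow; case: ifP; rewrite ?inve_ge0 poweR_ge0. Qed.

Lemma epow_fin (R : realType) (x r : R) : 0 < x -> epow x%:E r = (x `^ r)%:E.
Proof.
move=> x0; rewrite /epow; case: ifP => // _; rewrite poweR_EFin inver.
by rewrite gt_eqF ?powR_gt0// -powRN opprK.
Qed.

Lemma epow_antitone (R : realType) (x y : \bar R) (r : R) : r < 0 ->
  (0 <= x -> x <= y -> epow y r <= epow x r)%E.
Proof.
move=> r0 x0 xy; have y0 := le_trans x0 xy.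
rewrite /epow r0 lee_pV2 ?inE ?poweR_ge0//.
apply: gt0_ler_poweR => //; first by rewrite oppr_ge0 ltW.
- by rewrite in_itv/= x0 leey.
- by rewrite in_itv/= y0 leey.
Qed.

Lemma sum_geometric_le (R : realType) (a b x y : R) :
  0 <= a -> 0 <= b -> 0 < x < 1 -> 0 < y < 1 ->
  (\sum_(k <oo) (a * x ^+ k + b * y ^+ k)%:E <=
    (a / (1 - x) + b / (1 - y))%:E)%E.
Proof.
move=> a0 b0 /andP[x0 x1] /andP[y0 y1].
have pos k : 0 <= a * x ^+ k + b * y ^+ k.
  by rewrite addr_ge0// mulr_ge0// exprn_ge0// ltW.
apply: lime_le; first by apply: is_cvg_nneseries => k _ _; rewrite lee_fin.
apply: nearW => n; rewrite sumEFin lee_fin big_split/= lerD//.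
  by rewrite (le_trans _ (geometric_le_lim n a0 x0 _))// ger0_norm ?ltW.
by rewrite (le_trans _ (geometric_le_lim n b0 y0 _))// ger0_norm ?ltW.
Qed.

(** * Negative moments from two bounds on sublevel sets *)

Section layer_cake.
Local Open Scope classical_set_scope.
Local Open Scope ereal_scope.
Context d (T : measurableType d) (R : realType).
Variable mu : {measure set T -> \bar R}.

(** The integral of a nonnegative function is a supremum over the simple functions below it.
    Arbitrary functions are allowed, so that it applies directly to [epow] of an operator value. *)
Lemma ge0_le_integralT (f g : T -> \bar R) : (forall x, 0 <= f x) ->
  (forall x, f x <= g x) -> \int[mu]_x f x <= \int[mu]_x g x.
Proof.
move=> f0 fg; have g0 x : 0 <= g x by exact: le_trans (f0 x) (fg x).
rewrite !ge0_integralTE//; apply: ereal_sup_le => _ [h /= hf <-].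
by exists h => // x; exact: le_trans (hf x) (fg x).
Qed.

(** These are indicators of full sublevel sets, not of shells: the overcount is harmless, and each
    integral becomes a measure that the hypotheses bound. *)
Definition below (l : R) (k : nat) (y : \bar R) : R :=
  if y < (expR (l - k%:R))%:E then 1%R else 0%R.

Definition above (l : R) (k : nat) (y : \bar R) : R :=
  if y < (expR (l + k.+1%:R))%:E then 1%R else 0%R.

(* Dominates y^(-s) on e^(l-k-1) <= y < e^(l-k) and e^(l+k) <= y < e^(l+k+1). *)
Definition layer (s l : R) (y : \bar R) (k : nat) : R :=
  (expR (s * (k%:R + 1 - l)) * below l k y +
   expR (- s * (l + k%:R)) * above l k y)%R.

Lemma layer_ge0 s l y k : (0 <= layer s l y k)%R.
Proof.
by rewrite /layer addr_ge0// mulr_ge0 ?expR_ge0// /below /above; case: ifP.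
Qed.

Lemma epow_le_layers (s l : R) (y : \bar R) : (0 < s)%R -> 0 <= y ->
  epow y (- s) <= \sum_(k <oo) (layer s l y k)%:E.
Proof.
move=> s0 y0; pose u k := (layer s l y k)%:E.
have u0 k : 0 <= u k by rewrite lee_fin layer_ge0.
have ule k : u k <= \sum_(j <oo) u j.
  apply: le_trans (nneseries_lim_ge k.+1 _) => //.
  by rewrite big_nat_recr//= leeDr// sume_ge0.
have lnR r : (0 < r)%R -> r = expR (l + (ln r - l)).
  by move=> r0; rewrite addrC subrK lnK ?posrE.
case: y y0 @u u0 ule => [r| |//] r0 u u0 ule; last first.
  rewrite /epow oppr_lt0 s0 opprK/= gt_eqF// invey.
  by apply: nneseries_ge0 => k _ _; exact: u0.
have [r_lt0|r_gt0|r0'] := ltgtP r 0%R.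
- by move: r0; rewrite lee_fin leNgt r_lt0.
- rewrite epow_fin//; set t := (ln r - l)%R.
  have rE : r = expR (l + t) by exact: lnR.
  have -> : (r `^ (- s))%R = expR (- s * (l + t)).
    by rewrite rE mulrC expRM.
  (* A single layer suffices, selected by the integer part of [t]: the [above] term if it is a
     natural number [k], the [below] term if it is [-(k+1)]. *)
  have := floor_itv t; case: (Num.floor t) => k /andP[kt tk].
    have {}kt : (k%:R <= t)%R by [].
    have {}tk : (t < k.+1%:R)%R by move: tk; rewrite -natr1 intrD.
    apply: le_trans (ule k); rewrite lee_fin.
    rewrite /layer /below /above rE !lte_fin !ltr_expR !ltrD2l tk mulr1.
    rewrite -[leLHS]add0r lerD//.
      by rewrite mulr_ge0 ?expR_ge0//; case: ifP.
    by rewrite ler_expR; nra.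
  have {}kt : (- k.+1%:R <= t)%R by move: kt; rewrite NegzE mulrNz.
  have {}tk : (t < - k%:R)%R.
    by move: tk; rewrite NegzE -addn1 PoszD opprD subrK mulrNz.
  apply: le_trans (ule k); rewrite lee_fin.
  rewrite /layer /below /above rE !lte_fin !ltr_expR !ltrD2l tk mulr1.
  rewrite -[leLHS]addr0 lerD//; last first.
    by rewrite mulr_ge0 ?expR_ge0//; case: ifP.
  by rewrite ler_expR; move: kt; rewrite -natr1; nra.
(* At 0 the left side is [+oo]. Layer [k] is at least [expR (s (k+1-l))], hence at least
   [s (k+1-l)], which exceeds any given [A] once [k+1 > A/s + l]. *)
- suff -> : \sum_(k <oo) u k = +oo by rewrite leey.
  apply/eqyP => A A0.
  pose k := Num.truncn (A / s + l).
  apply: le_trans (ule k); rewrite lee_fin.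
  rewrite /layer /below r0' lte_fin expR_gt0 mulr1.
  rewrite -[leLHS]addr0 lerD//; last first.
    by rewrite mulr_ge0 ?expR_ge0// /above; case: ifP.
  apply: le_trans (expR_ge1Dx _).
  have /ltW : (A / s + l < k.+1%:R)%R by exact: truncnS_gt.
  rewrite -natr1 -lerBrDr ler_pdivrMr// => h.
  by rewrite -[leLHS]add0r lerD// (le_trans h)// mulrC.
Qed.
(** The sum of the two geometric series over the layers below and above [e^l]. The numerators appear
    because the weight is taken at the lower end of a layer and the measure at its upper end, one
    unit of the exponent apart. *)
Definition moment_cst (s s1 s2 : R) : R :=
  expR s / (1 - expR (s - s1)) + expR s2 / (1 - expR (s2 - s)).

Lemma moment_cst_gt0 (s s1 s2 : R) : (s2 < s < s1 -> 0 < moment_cst s s1 s2)%R.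
Proof.
by move=> /andP[? ?]; rewrite addr_gt0// divr_gt0 ?expR_gt0// subr_gt0 expR_lt1
  subr_lt0.
Qed.

(* The integral is cut at the level e^l where the two bounds coincide. *)
Lemma negative_moment_le (s s1 s2 k1 k2 : R) (h : T -> \bar R) :
    (0 < s)%R -> (s2 < s < s1)%R ->
    measurable_fun [set: T] h -> (forall x, 0 <= h x) ->
    (forall t : R,
      mu [set x | h x < (expR t)%:E] <= (expR (s1 * (t + k1)))%:E) ->
    (forall t : R,
      mu [set x | h x < (expR t)%:E] <= (expR (s2 * (t + k2)))%:E) ->
  \int[mu]_x epow (h x) (- s) <=
    (moment_cst s s1 s2 * expR ((s - s2) / (s1 - s2) * (s1 * k1) +
                             (s1 - s) / (s1 - s2) * (s2 * k2)))%:E.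
Proof.
move=> s0 /andP[s2s ss1] mh h0 h1 h2.
have s12 : (s1 - s2 != 0)%R by rewrite subr_eq0 gt_eqF// (lt_trans s2s).
pose l := ((s2 * k2 - s1 * k1) / (s1 - s2))%R.
have mlt (c : R) : measurable [set x | h x < c%:E].
  rewrite -[X in measurable X]setTI.
  exact: emeasurable_fun_infty_o.
have indE (c : R) x : 
    (if h x < c%:E then 1%R else 0%R) = \1_[set x | h x < c%:E] x :> R.
  rewrite /indic; case: ifPn => hc; first by rewrite mem_set.
  by rewrite memNset// => /(negP hc).
apply: le_trans (ge0_le_integralT (fun x => epow_ge0 _ (h0 x))
  (fun x => epow_le_layers l s0 (h0 x))) _.
have mbelow k : measurable_fun [set: T] (fun x => below l k (h x)).
  rewrite /below; under eq_fun do rewrite indE.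
  exact: measurable_indic.
have mabove k : measurable_fun [set: T] (fun x => above l k (h x)).
  rewrite /above; under eq_fun do rewrite indE.
  exact: measurable_indic.
have below0 k x : (0 <= below l k (h x))%R by rewrite /below; case: ifP.
have above0 k x : (0 <= above l k (h x))%R by rewrite /above; case: ifP.
rewrite integral_nneseries//; last 2 first.
- move=> k; apply/measurable_EFinP; apply: measurable_funD;
    exact: measurable_funM.
- by move=> k x _; rewrite lee_fin layer_ge0.
set E := expR (_ + _).
(* [E] is [e^(-s l)] times the common value of both bounds at [e^l]. Below that level the weight
   grows like [e^(s k)] while [h1] decays like [e^(-s1 k)]; above it the weight decays like
   [e^(-s k)] while [h2] grows like [e^(s2 k)]. Both ratios are below 1 since [s2 < s < s1]. *)
have step k : \int[mu]_x (layer s l (h x) k)%:E <=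
    (E * expR s * expR (s - s1) ^+ k + E * expR s2 * expR (s2 - s) ^+ k)%:E.
  under eq_integral do rewrite EFinD.
  rewrite ge0_integralD//; last 4 first.
  - by move=> x _; rewrite lee_fin mulr_ge0 ?expR_ge0.
  - by apply/measurable_EFinP; exact: measurable_funM.
  - by move=> x _; rewrite lee_fin mulr_ge0 ?expR_ge0.
  - by apply/measurable_EFinP; exact: measurable_funM.
  under eq_integral do rewrite EFinM.
  rewrite ge0_integralZl_EFin ?expR_ge0//; last 2 first.
  - by move=> x _; rewrite lee_fin.
  - exact/measurable_EFinP.
  under [X in _ + X]eq_integral do rewrite EFinM.
  rewrite ge0_integralZl_EFin ?expR_ge0//; last 2 first.
  - by move=> x _; rewrite lee_fin.
  - exact/measurable_EFinP.
  rewrite /below /above.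
  under eq_integral do rewrite indE.
  under [X in _ + _ * X]eq_integral do rewrite indE.
  rewrite !integral_indic// !setIT EFinD; apply: leeD.
  - apply: le_trans (lee_wpmul2l _ (h1 _)) _; first by rewrite lee_fin expR_ge0.
    rewrite -EFinM lee_fin /E -expRM_natl -!expRD ler_expR le_eqVlt.
    by apply/orP; left; apply/eqP; rewrite /l; field.
  - apply: le_trans (lee_wpmul2l _ (h2 _)) _; first by rewrite lee_fin expR_ge0.
    rewrite -EFinM lee_fin /E -expRM_natl -!expRD ler_expR le_eqVlt.
    by apply/orP; left; apply/eqP; rewrite /l -natr1; field.
apply: le_trans (lee_nneseries _ (fun k _ => step k)) _.
  by move=> k _ _; apply: integral_ge0 => x _; rewrite lee_fin layer_ge0.
apply: le_trans (sum_geometric_le _ _ _ _) _.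
- by rewrite mulr_ge0 ?expR_ge0.
- by rewrite mulr_ge0 ?expR_ge0.
- by rewrite expR_gt0 expR_lt1 subr_lt0.
- by rewrite expR_gt0 expR_lt1 subr_lt0.
by rewrite lee_fin /moment_cst [leRHS]mulrC mulrDr !mulrA.
Qed.

End layer_cake.

(** * Hoelder's inequality and truncation for integrals of powers *)

Section power_integrals.
Local Open Scope classical_set_scope.
Local Open Scope ereal_scope.
Context d (T : measurableType d) (R : realType).
Variable mu : {measure set T -> \bar R}.
Implicit Types (f : T -> R) (r p M : R).

Lemma measurable_powR_EFin f (r : R) : measurable_fun [set: T] f ->
  measurable_fun [set: T] (fun x => ((f x `^ r)%R)%:E).
Proof.
move=> mf; apply/measurable_EFinP.
exact: (measurableT_comp (measurable_powR r)).
Qed.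

Lemma integral_powR_ge0 f (r : R) : 0 <= \int[mu]_x ((f x `^ r)%R)%:E.
Proof. by apply: integral_ge0 => x _; rewrite lee_fin powR_ge0. Qed.

(** Log-convexity in the exponent: Hoelder's inequality with exponents [1/u] and [1/v] for the
    product of [f^(r1 u)] and [f^(r2 v)]. *)
Lemma integral_powR_hoelder f (r1 r2 u v : R) :
    measurable_fun [set: T] f -> (0 < r1)%R -> (0 < r2)%R ->
    (0 < u)%R -> (0 < v)%R -> (u + v = 1)%R ->
  \int[mu]_x ((f x `^ (r1 * u + r2 * v))%R)%:E <=
    (\int[mu]_x ((f x `^ r1)%R)%:E) `^ u * (\int[mu]_x ((f x `^ r2)%R)%:E) `^ v.
Proof.
move=> mf r10 r20 u0 v0 uv.
have mfr r : measurable_fun [set: T] (fun x => (f x `^ r)%R).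
  exact: (measurableT_comp (measurable_powR r)).
have normE (w r : R) : (0 < w)%R ->
    'N[mu]_((w^-1)%:E)[EFin \o (fun x => f x `^ (r * w))%R] =
    (\int[mu]_x ((f x `^ r)%R)%:E) `^ w.
  move=> w0; rewrite unlock; set I1 := integral _ _ _; set I2 := integral _ _ _.
  rewrite /= invrK; suff -> : I1 = I2 by [].
  apply: eq_integral => x _ /=.
  by rewrite ger0_norm ?powR_ge0// -powRrM mulfK ?gt_eqF.
rewrite -!normE//.
have := @hoelder _ _ _ mu _ _ (u^-1)%R (v^-1)%R
  (mfr (r1 * u)%R) (mfr (r2 * v)%R).
rewrite !invr_gt0 !invrK => /(_ u0 v0 uv); apply: le_trans.
rewrite Lnorm1 le_eqVlt; apply/orP; left; apply/eqP.
apply: eq_integral => x _ /=; rewrite ger0_norm ?mulr_ge0 ?powR_ge0// powRD//.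
by rewrite gt_eqF// addr_gt0// mulr_gt0.
Qed.

Definition truncation (M : R) f (x : T) : R :=
  if (M^-1 <= f x <= M)%R then f x else 0%R.

Lemma measurable_truncation M f : measurable_fun [set: T] f ->
  measurable_fun [set: T] (truncation M f).
Proof.
move=> mf; apply: measurable_fun_ifT => //.
by apply: measurable_and; exact: measurable_fun_ler.
Qed.

Lemma truncation_ge0 M f x : (0 <= f x -> 0 <= truncation M f x)%R.
Proof. by rewrite /truncation; case: ifP. Qed.

Lemma truncation_le M f x : (0 <= f x -> truncation M f x <= f x)%R.
Proof. by rewrite /truncation; case: ifP. Qed.

(** Where [f] is kept, [f^(r-p)] is at most [M^|r-p|]: through [f <= M] if [r >= p], through
    [1/f <= M] otherwise. *)
Lemma powR_truncation_le M f r p x : (1 <= M)%R -> (0 < r)%R ->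
  (truncation M f x `^ r <= M `^ `|r - p| * f x `^ p)%R.
Proof.
move=> M1 r0; rewrite /truncation; case: ifPn => [/andP[Mf fM]|_]; last first.
  by rewrite powR0 ?gt_eqF// mulr_ge0 ?powR_ge0.
have M0 : (0 < M)%R by exact: lt_le_trans M1.
have f0 : (0 < f x)%R by rewrite (lt_le_trans _ Mf)// invr_gt0.
have -> : (f x `^ r = f x `^ (r - p) * f x `^ p)%R.
  by rewrite -powRD ?subrK// (gt_eqF f0) implybT.
apply: ler_wpM2r; first exact: powR_ge0.
have [rp|/ltW rp] := leP 0%R (r - p)%R.
  by rewrite ger0_norm// ge0_ler_powR// nnegrE ltW.
have -> : (f x `^ (r - p) = (f x)^-1 `^ (- (r - p)))%R.
  by rewrite -powR_inv1 ?ltW// -powRrM mulN1r opprK.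
rewrite ler0_norm//; apply: ge0_ler_powR.
- by rewrite oppr_ge0.
- by rewrite nnegrE invr_ge0 ltW.
- by rewrite nnegrE ltW.
by rewrite -[X in (_ <= X)%R]invrK lef_pV2 ?posrE ?invr_gt0.
Qed.

(** By monotone convergence the integrals for [M = N+1] increase to the full integral [I]. If all of
    them stayed below [I/2], then [I <= I/2], impossible for [0 < I < +oo]. *)
Lemma exists_truncation f p : measurable_fun [set: T] f ->
    (forall x, (0 <= f x)%R) -> (0 < p)%R ->
    0 < \int[mu]_x ((f x `^ p)%R)%:E < +oo ->
  exists2 M : R, (1 <= M)%R & (2^-1)%:E * \int[mu]_x ((f x `^ p)%R)%:E <=
    \int[mu]_x ((truncation M f x `^ p)%R)%:E.
Proof.
move=> mf f0 p0 /andP[I0 Ioo]; set I := integral _ _ _.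
apply: contrapT => hN.
pose g N x := ((truncation N.+1%:R f x `^ p)%R)%:E.
have gI N : \int[mu]_x g N x <= (2^-1)%:E * I.
  rewrite leNgt; apply/negP => /ltW h; apply: hN.
  by exists N.+1%:R => //; rewrite ler1n.
have g_nd x : {homo g^~ x : a b / (a <= b)%N >-> a <= b}.
  move=> a b ab; rewrite lee_fin; apply: ge0_ler_powR;
    rewrite ?nnegrE ?truncation_ge0 ?(ltW p0)//.
  rewrite /truncation; case: ifPn => [/andP[h1 h2]|_]; last by case: ifP.
  rewrite ifT// (le_trans h2) ?ler_nat// andbT (le_trans _ h1)//.
  by rewrite lef_pV2 ?posrE ?ltr0n// ler_nat.
have gf x : g^~ x @ \oo --> ((f x `^ p)%R)%:E.
  apply: cvg_near_cst.
  have [fx0|fx0] := eqVneq (f x) 0%R.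
    apply: nearW => N; rewrite /g /truncation fx0; by case: ifP.
  have {}fx0 : (0 < f x)%R by rewrite lt_neqAle eq_sym fx0 f0.
  (* From this rank on, [N+1] exceeds both [f x] and [1 / f x], so the truncation keeps the value at
     [x]. *)
  exists (maxn (Num.truncn (f x)) (Num.truncn (f x)^-1)) => // N /=.
  rewrite geq_max => /andP[N1 N2]; rewrite /g /truncation ifT//.
  apply/andP; split.
    rewrite -[X in (_ <= X)%R]invrK lef_pV2 ?posrE ?ltr0n ?invr_gt0//.
    by rewrite (le_trans (ltW (truncnS_gt _)))// ler_nat.
  by rewrite (le_trans (ltW (truncnS_gt _)))// ler_nat.
have cI : \int[mu]_x g N x @[N --> \oo] --> I.
  have -> : I = \int[mu]_x limn (g^~ x).
    by apply: eq_integral => x _; apply/esym/cvg_lim => //; exact: gf.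
  apply: cvg_monotone_convergence => //.
  - by move=> N; apply: measurable_powR_EFin; exact: measurable_truncation.
  - by move=> N x _; rewrite lee_fin powR_ge0.
have : I <= (2^-1)%:E * I.
  rewrite -{1}(cvg_lim _ cI)//; apply: lime_le; last first.
    by apply: nearW => N; exact: gI.
  by apply/cvg_ex; exists I.
have Ifin : I \is a fin_num by rewrite ge0_fin_numE// ltW.
rewrite -(fineK Ifin) -EFinM lee_fin.
have : (0 < fine I)%R by rewrite fine_gt0// I0.
by lra.
Qed.

End power_integrals.

(** * Membership and interpolation in L^r *)

Section Lr.
Local Open Scope classical_set_scope.
Local Open Scope ereal_scope.
Context (R : realType) (n : nat).
Notation X := (Rn R n).
Notation mu := (@leb R n).
Implicit Types (f g : X -> R) (r p : R).

Lemma integral_epow f r : nonneg f -> (0 < r)%R ->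
  \int[mu]_x epow `|(f x)%:E| r = \int[mu]_x ((f x `^ r)%R)%:E.
Proof.
move=> f0 r0; apply: eq_integral => x _.
by rewrite /epow ltNge (ltW r0) /= ger0_norm.
Qed.

Lemma Lr_normE f r : nonneg f -> (0 < r)%R ->
  Lr_norm r (EFin \o f) = (\int[mu]_x ((f x `^ r)%R)%:E) `^ r^-1.
Proof.
move=> f0 r0; rewrite /Lr_norm -integral_epow// /epow.
by rewrite invr_lt0 [(r < 0)%R]ltNge (ltW r0).
Qed.

Lemma memLr_lty f r : nonneg f -> (0 < r)%R -> memLr r f ->
  \int[mu]_x ((f x `^ r)%R)%:E < +oo.
Proof. by move=> f0 r0 [_]; rewrite integral_epow. Qed.

Lemma memLr_le f g r p (c : R) : (0 < r)%R -> (0 < p)%R -> (0 <= c)%R ->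
    measurable_fun [set: X] g -> nonneg g -> nonneg f ->
    (forall x, g x `^ r <= c * f x `^ p)%R -> memLr p f -> memLr r g.
Proof.
move=> r0 p0 c0 mg g0 f0 gf Lf; split => //.
rewrite integral_epow//.
have mf : measurable_fun [set: X] f by case: Lf.
apply: (@le_lt_trans _ _ (c%:E * \int[mu]_x ((f x `^ p)%R)%:E)).
  rewrite -ge0_integralZl_EFin; last 4 first.
  - exact: measurableT.
  - by move=> x _; rewrite lee_fin powR_ge0.
  - exact: measurable_powR_EFin.
  - exact: c0.
  apply: ge0_le_integralT => x; first by rewrite lee_fin powR_ge0.
  by rewrite -EFinM lee_fin.
by rewrite lte_mul_pinfty// memLr_lty.
Qed.

Lemma memLr_truncation f r p (M : R) : (1 <= M)%R -> (0 < r)%R -> (0 < p)%R ->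
  nonneg f -> memLr p f -> memLr r (truncation M f).
Proof.
move=> M1 r0 p0 f0 Lf.
apply: (memLr_le r0 p0 (powR_ge0 M `|r - p|%R) _ _ f0 _ Lf).
- by apply: measurable_truncation; case: Lf.
- by move=> x; exact: truncation_ge0.
- by move=> x; exact: powR_truncation_le.
Qed.

Lemma Lr_norm_ge0 r (g : X -> \bar R) : 0 <= Lr_norm r g.
Proof. by apply: epow_ge0; apply: integral_ge0 => x _; exact: epow_ge0. Qed.

Lemma memLr_norm_fin_num f r : nonneg f -> (0 < r)%R -> memLr r f ->
  Lr_norm r (EFin \o f) \is a fin_num.
Proof.
move=> f0 r0 Lf; rewrite (Lr_normE f0 r0); apply: fin_num_poweR.
by rewrite ge0_fin_numE ?integral_powR_ge0; first exact: memLr_lty f0 r0 Lf.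
Qed.

(** Lyapunov's inequality: the weights [u = p (1-theta) / p1] and [v = p theta / p2] satisfy
    [u + v = 1] and [p1 u + p2 v = p], so [integral_powR_hoelder] applies, and the power [1/p] is
    taken. *)
Lemma Lr_norm_interpolation (p1 p2 p theta : R) f :
    (0 < p1)%R -> (0 < p2)%R -> (0 < p)%R -> (0 < theta < 1)%R ->
    (p^-1 = (1 - theta) / p1 + theta / p2)%R ->
    measurable_fun [set: X] f -> nonneg f ->
  Lr_norm p (EFin \o f) <=
  Lr_norm p1 (EFin \o f) `^ (1 - theta) * Lr_norm p2 (EFin \o f) `^ theta.
Proof.
move=> p10 p20 p0 /andP[t0 t1] hp mf f0.
have uv : (p * (1 - theta) / p1 + p * theta / p2 = 1)%R.
  by rewrite -!mulrA -mulrDr -hp mulfV ?gt_eqF.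
have pE : p = (p1 * (p * (1 - theta) / p1) + p2 * (p * theta / p2))%R.
  by field; rewrite !gt_eqF.
have := @integral_powR_hoelder _ _ _ mu f p1 p2 _ _ mf p10 p20 _ _ uv.
rewrite -pE !divr_gt0 ?mulr_gt0 ?subr_gt0// => /(_ isT isT) H.
rewrite !Lr_normE// -!poweRrM.
have -> : (p1^-1 * (1 - theta) = p * (1 - theta) / p1 * p^-1)%R.
  by field; rewrite !gt_eqF.
have -> : (p2^-1 * theta = p * theta / p2 * p^-1)%R.
  by field; rewrite !gt_eqF.
rewrite [in leRHS]poweRrM [X in _ * X]poweRrM -poweRM ?poweR_ge0//.
apply: gt0_ler_poweR => //.
- by rewrite invr_ge0 ltW.
- by rewrite in_itv/= integral_powR_ge0 leey.
- by rewrite in_itv/= mule_ge0 ?poweR_ge0// leey.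
Qed.

End Lr.

(** * Positivity of the operator and its weak type bounds *)

Section operator.
Local Open Scope classical_set_scope.
Local Open Scope ereal_scope.
Context (R : realType) (n : nat) (T : linear_operator R n).
Notation X := (Rn R n).
Notation mu := (@leb R n).
Implicit Types (f g : X -> R) (r p : R).
Hypothesis Tpos : preserves_nonneg T.

(** Both images are nonnegative almost everywhere, so their sum never has the form [+oo - oo] and
    [op_linear] applies with coefficients 1. *)
Lemma op_addE f g : dom T f -> dom T g -> nonneg f -> nonneg g ->
  dom T (f \+ g)%R /\ {ae mu, forall x, T (f \+ g)%R x = T f x + T g x}.
Proof.
move=> df dg f0 g0.
have [|] := @op_linear _ _ T 1%R 1%R f g df dg.
  have := Tpos df f0; have := Tpos dg g0; apply: filterS2 => x Tg Tf.
  by rewrite !mul1e ge0_adde_def.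
have -> : (fun x => 1 * f x + 1 * g x)%R = (f \+ g)%R.
  by apply/funext => x; rewrite !mul1r.
move=> dfg Tfg; split => //; apply: filterS Tfg => x ->.
by rewrite !mul1e.
Qed.

(** Splitting by the size of [f]: the part with [f >= 1] is in L^p1 because [p1 < p], the part with
    [f < 1] is in L^p2 because [p < p2], and weak type puts both in the domain. *)
Lemma dom_memLr f (p1 q1 C1 p2 q2 C2 p : R) :
    weak_type T p1 q1 C1 -> weak_type T p2 q2 C2 ->
    (0 < p1)%R -> (p1 < p < p2)%R -> memLr p f -> nonneg f -> dom T f.
Proof.
move=> W1 W2 p10 /andP[p1p pp2] Lf f0.
have mf : measurable_fun [set: X] f by case: Lf.
have p0 : (0 < p)%R by exact: lt_trans p1p.
pose f1 x : R := if (1 <= f x)%R then f x else 0%R.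
pose f2 x : R := if (1 <= f x)%R then 0%R else f x.
have f10 : nonneg f1 by move=> x; rewrite /f1; case: ifP.
have f20 : nonneg f2 by move=> x; rewrite /f2; case: ifP.
have mb : measurable_fun [set: X] (fun x => (1 <= f x)%R).
  exact: measurable_fun_ler.
have L1 : memLr p1 f1.
  apply: (memLr_le p10 p0 ler01 _ f10 f0 _ Lf); first exact: measurable_fun_ifT.
  move=> x; rewrite /f1 mul1r; case: ifPn => [fx|_].
    by rewrite ler_powR// ltW.
  by rewrite powR0 ?powR_ge0// gt_eqF.
have L2 : memLr p2 f2.
  have p20 : (0 < p2)%R by exact: lt_trans pp2.
  apply: (memLr_le p20 p0 ler01 _ f20 f0 _ Lf); first exact: measurable_fun_ifT.
  move=> x; rewrite /f2 mul1r; case: ifPn => [_|fx].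
    by rewrite powR0 ?powR_ge0// gt_eqF.
  have [->|fx0] := eqVneq (f x) 0%R; first by rewrite !powR0// gt_eqF.
  apply: ger_powR; last exact: ltW.
  by rewrite lt_neqAle eq_sym fx0 f0/= ltW// ltNge.
have -> : f = (f1 \+ f2)%R.
  by apply/funext => x; rewrite /f1 /f2 /=; case: ifP; rewrite ?addr0 ?add0r.
exact: (op_addE (W1 _ L1 f10).1 (W2 _ L2 f20).1 f10 f20).1.
Qed.

(** Almost everywhere [T f = T g + T (f - g)] with both terms nonnegative. *)
Lemma op_le f g : dom T g -> dom T (f \- g)%R -> nonneg g ->
    (forall x, g x <= f x)%R ->
  {ae mu, forall x, `|T g x| <= `|T f x|}.
Proof.
move=> dg dfg g0 gf.
have h0 : nonneg (f \- g)%R by move=> x; rewrite /= subr_ge0.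
have [_] := op_addE dg dfg g0 h0.
have -> : (g \+ (f \- g))%R = f.
  by apply/funext => x /=; rewrite addrC subrK.
have := Tpos dg g0; have := Tpos dfg h0; apply: filterS3 => x Th Tg ->.
by rewrite !gee0_abs ?adde_ge0// leeDl.
Qed.

Lemma measurable_op_lt f (c : R) : dom T f ->
  measurable [set x : X | `|T f x| < c%:E].
Proof.
move=> df; rewrite -[X in measurable X]setTI.
apply: emeasurable_fun_infty_o; first exact: measurableT.
by apply: measurableT_comp; [exact: abse_measurable|exact: op_measurable].
Qed.

(** The exceptional null set is adjoined to the sublevel set of [T g], which leaves its measure
    unchanged. *)
Lemma op_lt_measure_le f g (c : R) : dom T f -> dom T g ->
    {ae mu, forall x, `|T g x| <= `|T f x|} ->
  mu [set x | `|T f x| < c%:E] <= mu [set x | `|T g x| < c%:E].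
Proof.
move=> df dg [N [mN N0 subN]].
rewrite -[leRHS](measureU0 _ mN N0); last exact: measurable_op_lt.
apply: le_measure; rewrite ?inE.
- exact: measurable_op_lt.
- by apply: measurableU => //; exact: measurable_op_lt.
move=> x /= Tfx; have [gf|gf] := leP `|T g x| `|T f x|.
  by left; exact: le_lt_trans Tfx.
by right; apply: subN => /=; rewrite leNgt gf.
Qed.

(** With [tau = e^t] the weak bound takes the form required by [negative_moment_le], with slope [-q]
    and shift [- ln (C a)]. *)
Lemma weak_type_expR f (p q C a : R) : weak_type T p q C -> memLr p f ->
    nonneg f -> (0 < C)%R -> (0 < a)%R -> Lr_norm p (EFin \o f) = a%:E ->
  forall t : R, mu [set x | `|T f x| < (expR t)%:E] <=
    (expR (- q * (t + - ln (C * a))))%:E.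
Proof.
move=> W Lf f0 C0 a0 Na t.
apply: le_trans ((W f Lf f0).2 _ (expR_gt0 t)) _.
rewrite Na -!EFinM epow_fin ?mulr_gt0 ?invr_gt0 ?expR_gt0// lee_fin.
have Ca : (C * a = expR (ln (C * a)))%R by rewrite lnK// posrE mulr_gt0.
rewrite {1}Ca -expRN -expRD -expRM ler_expR le_eqVlt.
by apply/orP; left; apply/eqP; ring.
Qed.

End operator.

(** * Interpolation between the two weak types *)

Unset Implicit Arguments.
Set Strict Implicit.

Theorem proposition2p2 (R : realType) (p1 q1 p2 q2 theta p q C1 C2 : R)
    (hp1 : 0 < p1 < 1) (hq1 : q1 < 0) (hp2 : 0 < p2 < 1) (hq2 : q2 < 0)
    (hp12 : p1 < p2) (hq12 : q1 < q2) (htheta : 0 < theta < 1)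
    (hp : p^-1 = (1 - theta) / p1 + theta / p2)
    (hq : q^-1 = (1 - theta) / q1 + theta / q2)
    (hC1 : 0 < C1) (hC2 : 0 < C2) :
  exists2 C : R, 0 < C &
    forall (n : nat) (T : linear_operator R n),
      preserves_nonneg T ->
      weak_type T p1 q1 C1 ->
      weak_type T p2 q2 C2 ->
      reversed_strong_type T p q C.
Proof.
have [/andP[p10 _] /andP[p20 _] /andP[t0 t1]] := And3 hp1 hp2 htheta.
have p_gt0 : 0 < p.
  by rewrite -invr_gt0 hp addr_gt0// divr_gt0// subr_gt0.
have q_lt0 : q < 0.
  have : q1^-1 < 0 by rewrite invr_lt0.
  have : q2^-1 < 0 by rewrite invr_lt0.
  by rewrite -(invr_lt0 q) hq; nra.
have p1p : p1 < p.
  rewrite -ltf_pV2 ?posrE// hp.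
  have : p2^-1 < p1^-1 by rewrite ltf_pV2 ?posrE.
  by nra.
have pp2 : p < p2.
  rewrite -ltf_pV2 ?posrE// hp.
  have : p2^-1 < p1^-1 by rewrite ltf_pV2 ?posrE.
  by nra.
have q21 : q2^-1 < q1^-1 by rewrite ltf_nV2 ?negrE.
have q1q : q1 < q.
  by rewrite -ltf_nV2 ?negrE// hq; nra.
have qq2 : q < q2.
  by rewrite -ltf_nV2 ?negrE// hq; nra.
pose M0 := moment_cst (- q) (- q1) (- q2).
have qs : - q2 < - q < - q1 by rewrite !ltrN2 q1q qq2.
have M00 : 0 < M0 by exact: moment_cst_gt0.
(* The factors come from the moment bound raised to [1/q], from the two weak type constants, and
   from the half of the integral of [f^p] lost by truncation. *)
exists (M0 `^ q^-1 * (C1 `^ (1 - theta) * C2 `^ theta) * 2^-1 `^ p^-1).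
  by rewrite !mulr_gt0 ?powR_gt0// invr_gt0.
move=> n T Tpos W1 W2 f Lf f0.
have p1pp2 : p1 < p < p2 by rewrite p1p pp2.
have mf : measurable_fun setT f by case: Lf.
have df : dom T f by exact: (dom_memLr Tpos W1 W2 p10 p1pp2 Lf f0).
split => //.
pose I := (\int[leb]_x ((f x `^ p)%R)%:E)%E.
have I0 : (0 <= I)%E by exact: integral_powR_ge0.
have Ioo : (I < +oo)%E by exact: memLr_lty.
have [Iz|Iz] := eqVneq I 0%E.
  rewrite Lr_normE// -/I Iz poweR0r ?mule0 ?Lr_norm_ge0//.
  by rewrite invr_neq0// gt_eqF.
have {}I0 : (0 < I)%E by rewrite lt_neqAle eq_sym Iz I0.
have [M M1 MI] : exists2 M : R, 1 <= M & ((2^-1)%:E * I <=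
    \int[@leb R n]_x ((truncation M f x `^ p)%R)%:E)%E.
  by apply: exists_truncation => //; rewrite I0 Ioo.
pose g := truncation M f.
have g0 : nonneg g by move=> x; exact: truncation_ge0.
have gf x : g x <= f x by exact: truncation_le.
have Lg (r : R) : 0 < r -> memLr r g.
  by move=> r0; exact: memLr_truncation M1 r0 p_gt0 f0 Lf.
have mg : measurable_fun setT g by case: (Lg p p_gt0).
(* The difference has to lie in the domain as well, since [op_le] splits [f] into [g] and
   [f - g]. *)
have Lfg : memLr p (f \- g).
  apply: (memLr_le p_gt0 p_gt0 ler01 _ _ f0 _ Lf).
  - exact: measurable_funB.
  - by move=> x; rewrite /= subr_ge0.
  - move=> x; rewrite mul1r /=; apply: ge0_ler_powR.
    + exact: ltW.
    + by rewrite nnegrE subr_ge0.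
    + by rewrite nnegrE.
    + by rewrite lerBlDr lerDl.
have dg : dom T g by exact: (dom_memLr Tpos W1 W2 p10 p1pp2 (Lg p p_gt0) g0).
have dfg : dom T (f \- g).
  apply: (dom_memLr Tpos W1 W2 p10 p1pp2 Lfg).
  by move=> x; rewrite /= subr_ge0.
have Tgf := op_le Tpos dg dfg g0 gf.
have NfE : Lr_norm p (EFin \o f) = (I `^ p^-1)%E by exact: Lr_normE.
have Nfg : ((2^-1 `^ p^-1)%:E * Lr_norm p (EFin \o f) <=
    Lr_norm p (EFin \o g))%E.
  rewrite NfE Lr_normE// -poweR_EFin -poweRM ?lee_fin ?invr_ge0 ?(ltW I0)//.
  apply: gt0_ler_poweR => //.
  - by rewrite invr_ge0 ltW.
  - by rewrite in_itv/= leey mule_ge0 ?(ltW I0)// lee_fin invr_ge0.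
  - by rewrite in_itv/= integral_powR_ge0 leey.
have Ng := Lr_norm_interpolation p10 p20 p_gt0 htheta hp mg g0.
have Nfin (r : R) : 0 < r ->
    Lr_norm r (EFin \o g) = (fine (Lr_norm r (EFin \o g)))%:E.
  by move=> r0; apply/esym/fineK/(memLr_norm_fin_num g0 r0)/Lg.
pose a1 := fine (Lr_norm p1 (EFin \o g)).
pose a2 := fine (Lr_norm p2 (EFin \o g)).
have N1 : Lr_norm p1 (EFin \o g) = a1%:E by exact: Nfin.
have N2 : Lr_norm p2 (EFin \o g) = a2%:E by exact: Nfin.
rewrite N1 N2 !poweR_EFin -EFinM in Ng.
have NfNg := le_trans Nfg Ng.
(* Logarithms of [a1] and [a2] are taken below, so both must be positive. [NfNg] bounds this product
   below by a positive quantity, and it would vanish with either factor. *)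
have a_gt0 : 0 < a1 `^ (1 - theta) * a2 `^ theta.
  rewrite -lte_fin; apply: lt_le_trans NfNg; rewrite NfE; apply: mule_gt0.
    by rewrite lte_fin powR_gt0// invr_gt0.
  exact: (poweR_gt0 _ I0).
have a1_gt0 : 0 < a1.
  rewrite lt_neqAle fine_ge0 ?Lr_norm_ge0// andbT eq_sym.
  apply: contraTneq a_gt0 => ->.
  by rewrite powR0 ?mul0r ?ltxx// subr_eq0 gt_eqF.
have a2_gt0 : 0 < a2.
  rewrite lt_neqAle fine_ge0 ?Lr_norm_ge0// andbT eq_sym.
  apply: contraTneq a_gt0 => ->.
  by rewrite powR0 ?mulr0 ?ltxx// gt_eqF.
have mTf : measurable_fun setT (fun x => `|T f x|%E).
  by apply: measurableT_comp; [exact: abse_measurable|exact: op_measurable].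
have nq_gt0 : 0 < - q by rewrite oppr_gt0.
(* The weak bounds are used for [g], whose L^p1 and L^p2 norms are finite while those of [f] may be
   infinite; [T g <= T f] transfers them to the sublevel sets of [T f]. *)
have := negative_moment_le nq_gt0 qs mTf (fun x => abse_ge0 _)
  (fun t => le_trans (op_lt_measure_le _ df dg Tgf)
    (weak_type_expR W1 (Lg p1 p10) g0 hC1 a1_gt0 N1 t))
  (fun t => le_trans (op_lt_measure_le _ df dg Tgf)
    (weak_type_expR W2 (Lg p2 p20) g0 hC2 a2_gt0 N2 t)).
rewrite -/M0 opprK; set E := (_ * _ + _ * _) => bound.
rewrite {2}/Lr_norm.
have qV_lt0 : q^-1 < 0 by rewrite invr_lt0.
have int0 : (0 <= \int[leb]_x epow `|T f x| q)%E.
  by apply: integral_ge0 => x _; exact: epow_ge0.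
(* As [1/q < 0], the upper bound on the integral is a lower bound on the norm. *)
apply: le_trans (epow_antitone qV_lt0 int0 bound).
rewrite epow_fin ?mulr_gt0 ?expR_gt0// powRM ?expR_ge0 ?(ltW M00)// -expRM.
(* This is [hq] cleared of denominators. It shows that the weights of [ln (C1 a1)] and [ln (C2 a2)]
   in [E], divided by [q], are exactly [1 - theta] and [theta]. *)
have qE : q1 * q2 = q * ((1 - theta) * q2 + theta * q1).
  have -> : (1 - theta) * q2 + theta * q1 = q1 * q2 * q^-1.
    by rewrite hq; field; rewrite !lt_eqF.
  by field; rewrite lt_eqF.
have q12N : q2 - q1 != 0 by rewrite subr_eq0 gt_eqF.
have w1 : (q2 - q) * q1 = (1 - theta) * q * (q2 - q1).
  by rewrite mulrBl [q2 * q1]mulrC qE; ring.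
have w2 : (q - q1) * q2 = theta * q * (q2 - q1).
  by rewrite mulrBl qE; ring.
have -> : E * q^-1 = ln (C1 * a1) * (1 - theta) + ln (C2 * a2) * theta.
  have -> : E = ((q2 - q) * q1 * ln (C1 * a1) + (q - q1) * q2 * ln (C2 * a2))
      / (q2 - q1).
    by rewrite /E; field.
  by rewrite w1 w2; field; rewrite lt_eqF.
rewrite expRD !expRM !lnK ?posrE ?mulr_gt0// !powRM ?(ltW hC1) ?(ltW hC2)
  ?(ltW a1_gt0) ?(ltW a2_gt0)//.
rewrite EFinM -muleA.
apply: le_trans (lee_wpmul2l _ NfNg) _.
  by rewrite lee_fin !mulr_ge0 ?powR_ge0.
by rewrite -EFinM lee_fin le_eqVlt -!mulrA; apply/orP; left; apply/eqP; ring.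
Qed.
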